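(* Let $\lambda$ be a partition of a positive integer $n$, let $\alpha_1$ be the number of parts of $\lambda$ equal to $1$, and let $\lambda^+$ be the partition of $n+1$ obtained from $\lambda$ by adding one more part equal to $1$. Then the polynomials $R_{\lambda^+}$ and $R_\lambda$ have equal coefficients at $1,q,\dots,q^{\alpha_1}$. In other words, the polynomial $R_{\lambda^+}-R_\lambda$ is divisible by $q^{\alpha_1+1}$.
   Context: A partition of a positive integer $n$ is a sequence $\lambda=(\lambda_1,\dots,\lambda_N)$ of integers with $\lambda_1\ge\dots\ge\lambda_N>0$ and $\lambda_1+\dots+\lambda_N=n$. A strictly upper triangular matrix has Jordan type $\lambda$ if the sizes of its (nilpotent) Jordan blocks, listed in non-increasing order, are $\lambda_1,\dots,\lambda_N$. For a prime power $q$, $P_\lambda(q)$ denotes the number of strictly upper triangular $n\times n$ matrices over the finite field $\mathbb{F}_q$ of Jordan type $\lambda$. It is known that $P_\lambda(q)$ is given by a (nonzero) polynomial in $q$ with integer coefficients, also denoted $P_\lambda$. With $Q=q-1$, write $P_\lambda(q)=q^{d(\lambda)}Q^{e(\lambda)}R_\lambda(q)$, where $R_\lambda$ is a polynomial with $R_\lambda(0)\ne0$ and $R_\lambda(1)\ne0$; this determines the non-negative integers $d(\lambda)$, $e(\lambda)$ and the polynomial $R_\lambda$ uniquely. *)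

(* Defs.v *)
From mathcomp Require Import all_boot all_order all_algebra.

Set Implicit Arguments.
Unset Strict Implicit.
Unset Printing Implicit Defensive.

Import GRing.Theory.
Local Open Scope ring_scope.

Definition is_partition (n : nat) (lam : seq nat) : bool :=
  [&& sorted geq lam, all (leq 1) lam & sumn lam == n].

Definition strictly_upper (F : fieldType) (n : nat) (A : 'M[F]_n) : bool :=
  [forall i : 'I_n, [forall j : 'I_n, (j <= i)%N ==> (A i j == 0)]].

Definition nilp_block (F : fieldType) (m : nat) : 'M[F]_m :=
  \matrix_(i < m, j < m) (i.+1 == j :> nat)%:R.

Definition jordan_mx (F : fieldType) (lam : seq nat) :
    'M[F]_(\sum_(i < size lam) nth 0%N lam i) :=
  \mxdiag_(i < size lam) nilp_block F (nth 0%N lam i).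

(* [A] is similar to the block diagonal matrix [jordan_mx F lam].  When
   [sumn lam = n] the two sizes are equal but not convertible, so the change of
   basis [P] is typed as a rectangular matrix; it is square and invertible as
   it is both row free and row full. *)
Definition has_jordan_type (F : finFieldType) (n : nat) (A : 'M[F]_n)
    (lam : seq nat) : bool :=
  [exists P : 'M[F]_(\sum_(i < size lam) nth 0%N lam i, n),
    [&& row_free P, row_full P & P *m A == jordan_mx F lam *m P]].

Definition jordan_count (F : finFieldType) (n : nat) (lam : seq nat) : nat :=
  #|[set A : 'M[F]_n | strictly_upper A && has_jordan_type A lam]|.

(* [P] is the polynomial P_lam.  At most one [P] satisfies this, since its
   values at all prime powers are prescribed. *)
Definition is_jordan_count_poly (n : nat) (lam : seq nat) (P : {poly int}) :
    Prop :=
  forall F : finFieldType, P.[#|F|%:R] = (jordan_count F n lam)%:R.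

(* P = q^d Q^e R with Q = q - 1, which for P != 0 determines d, e and R. *)
Definition qQ_factorization (P : {poly int}) (d e : nat) (R : {poly int}) :
    Prop :=
  [/\ P = 'X^d * ('X - 1) ^+ e * R, R.[0] != 0 & R.[1] != 0].

(* Main.v *)
Require Import Defs.
From mathcomp Require Import all_boot all_order all_algebra.
From mathcomp Require Import mxabelem.
From mathcomp Require Import zify ring.

Set Implicit Arguments.
Unset Strict Implicit.
Unset Printing Implicit Defensive.

Import GRing.Theory Num.Theory.
Local Open Scope ring_scope.

(** The type of a nilpotent matrix [A] is read off its column profile
    [c k = rank (A ^ k) - rank (A ^ (k + 1))], the number of Jordan blocks of
    size larger than [k] (the conjugate partition, with columns numbered from
    0).  A strictly upper triangular matrix of size [n + 1] is a strictly upper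
    triangular matrix [A] of size [n] bordered by a row [u], and bordering
    raises exactly one entry of the profile by one: the entry [j], where [j] is
    the least number such that [u] lies in [im A + ker (A ^ j)].  That space has
    dimension [n - c j], so the number of rows [u] adding a box to column [j] is
    [q ^ (n - c 0)] if [j = 0] and [q ^ (n - c j) - q ^ (n - c (j - 1))]
    otherwise.  This gives a recursion for [P_lam] over the boxes that can be
    removed from [lam] ([col_countS]); every box outside the first column
    contributes one factor [q - 1] and a [q]-integer
    [1 + q + ... + q ^ (k - 1)].

    Write the column profile of [lam] as [b] followed by [t], where [b] is the
    number of parts, and let [m] be the sum of [t].  Adding a part equal to 1
    replaces [b] by [b + 1] and does not change [t], and the number of parts
    equal to 1 is [b - t 0].  Dividing out the powers of [q - 1] and of [q] that
    are visible in the recursion, one gets ([col_count_stab])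
    [P_lam = q ^ (b * (m - t 0)) * (q - 1) ^ m * f_t b], where
    - [f_t b = 1] if [t = 0];
    - otherwise [f_t b] is the sum of [q ^ (t 0) * f_t (b - 1)] (if [b > t 0])
      and of one term [q ^ x * [k] * f_(t - box) b] for every removable box
      of [t], with [x] independent of [b].  Here [[k]] is a [q]-integer, and
      [k = b - t 0 + 1] if the box is in column 0 of [t], while [k] does not
      depend on [b] for the other boxes.

    All coefficients are nonnegative, so nothing cancels and the order of
    vanishing [delta] of [f_t b] at [q = 0] is the minimum of the orders of the
    terms coming from the boxes; it does not depend on [b].  Hence
    [f_t b = q ^ delta * R_lam].  By induction on [m] and then on [b], the
    difference [f_t (b + 1) - f_t b] is divisible by
    [q ^ (delta + b - t 0 + 1)] ([stab_poly_stable]): the first term gains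
    [q ^ (t 0)] over the difference one step earlier, a box outside column 0
    reduces to a smaller [t] with the same [t 0], and a box in column 0 gives
    [[k + 1] - [k] = q ^ k] with [k = b - t 0 + 1].  Dividing by [q ^ delta]
    proves the theorem.

    Counting matrices by profile instead of by Jordan type requires that every
    nilpotent matrix has a Jordan form ([nilpotent_jordan_form]). *)

(** * Similarity and the ranks of powers of a Jordan matrix *)

Definition parts_gt (lam : seq nat) (k : nat) : nat :=
  count (fun x => k < x)%N lam.

Section Similarity.
Variable F : fieldType.

(** The two sizes are kept separate, as in [has_jordan_type], so that matrices
    of sizes that are only propositionally equal can be compared without casts. *)
Definition mxsimilar (m n : nat) (B : 'M[F]_m) (A : 'M[F]_n) : Prop :=
  exists P : 'M[F]_(m, n), [/\ row_free P, row_full P & P *m A = B *m P].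

Lemma has_jordan_typeP (K : finFieldType) n (A : 'M[K]_n) lam :
  reflect (exists P, [/\ row_free P, row_full P & P *m A = jordan_mx K lam *m P])
          (has_jordan_type A lam).
Proof.
apply: (iffP existsP) => [[P /and3P[fr fu /eqP eqP]]|[P [fr fu eqP]]].
  by exists P.
by exists P; rewrite fr fu eqP /=.
Qed.

Lemma mxsimilar_trans m n p (A : 'M[F]_m) (B : 'M[F]_n) (C : 'M[F]_p) :
  mxsimilar A B -> mxsimilar B C -> mxsimilar A C.
Proof.
move=> [P [frP fuP PE]] [Q [frQ fuQ QE]]; exists (P *m Q); split.
- by rewrite /row_free mxrankMfree.
- by rewrite /row_full (eqmxMfull Q fuP).
- by rewrite -mulmxA QE !mulmxA PE.
Qed.

Lemma mxsimilar_castmx m n (e : m = n) (A : 'M[F]_m) :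
  mxsimilar (castmx (e, e) A) A.
Proof.
by case: _ / e; exists 1%:M;
  rewrite castmx_id mulmx1 mul1mx row_free_unit row_full_unit unitmx1.
Qed.

Lemma mxsimilar_block m n p (A : 'M[F]_m) (B : 'M[F]_n) (C : 'M[F]_p) :
  mxsimilar B C -> mxsimilar (block_mx A 0 0 B) (block_mx A 0 0 C).
Proof.
move=> [P [frP fuP PE]]; exists (block_mx 1%:M 0 0 P); split.
- by rewrite /row_free rank_diag_block_mx mxrank1 (eqP frP).
- by rewrite /row_full rank_diag_block_mx mxrank1 (eqP fuP).
- by rewrite !mulmx_block !(mulmx0, mul0mx, mulmx1, mul1mx, addr0, add0r) PE.
Qed.

Lemma mxsimilar_exp m n (B : 'M[F]_m) (A : 'M[F]_n) (P : 'M[F]_(m, n)) k :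
  P *m A = B *m P -> P *m A ^+ k = B ^+ k *m P.
Proof.
move=> PE; elim: k => [|k IHk]; first by rewrite !expr0 mulmx1 mul1mx.
by rewrite !exprSr -!mulmxE mulmxA IHk -mulmxA PE mulmxA.
Qed.

Lemma mxsimilar_rank m n (B : 'M[F]_m) (A : 'M[F]_n) k :
  mxsimilar B A -> \rank (B ^+ k) = \rank (A ^+ k).
Proof.
move=> [P [frP fuP PE]].
by rewrite -(mxrankMfree (B ^+ k) frP) -(mxsimilar_exp k PE) (eqmxMfull _ fuP).
Qed.

Lemma mxsimilar_size m n (B : 'M[F]_m) (A : 'M[F]_n) : mxsimilar B A -> m = n.
Proof. by move=> [P [/eqP fr /eqP fu _]]; exact: etrans (esym fr) fu. Qed.

Lemma nilp_blockX m k i j : (nilp_block F m ^+ k) i j = ((i + k)%N == j)%:R.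
Proof.
elim: k i j => [|k IHk] i j; first by rewrite expr0 mxE addn0.
rewrite exprSr -mulmxE mxE; under eq_bigr do rewrite IHk mxE.
have [lt|ge] := ltnP (i + k) m.
  rewrite (bigD1 (Ordinal lt)) //= eqxx mul1r addnS big1 ?addr0 // => l ne.
  by case: eqP => [E|]; rewrite ?mul0r //; case/eqP: ne; apply/val_inj.
rewrite big1 => [|l _]; last first.
  by case: eqP => [E|]; rewrite ?mul0r //; have := ltn_ord l; rewrite -E ltnNge ge.
by case: eqP => // E; have := ltn_ord j; lia.
Qed.

(** The matrix [N ^ k] shifts the basis by [k] places, so that it and its
    transpose are inverse to each other on the first [m - k] basis vectors. *)
Lemma rank_nilp_blockX m k : \rank (nilp_block F m ^+ k) = (m - k)%N.
Proof.
set D := _ ^+ k; apply/eqP; rewrite eqn_leq; apply/andP; split.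
  have -> : D = pid_mx (m - k) *m D.
    apply/matrixP => i j; rewrite mxE (bigD1 i) //= big1 => [|l ne].
      rewrite mxE eqxx nilp_blockX addr0 /=.
      case: (ltnP i (m - k)) => h; rewrite ?mul1r // mul0r.
      by case: eqP => // E; have := ltn_ord j; lia.
    by rewrite mxE (negPf (_ : i != l :> nat)) ?mul0r // eq_sym.
  by rewrite (leq_trans (mxrankM_maxl _ _)) // rank_pid_mx ?leq_subr.
have DD : D *m D^T = pid_mx (m - k).
  apply/matrixP => i j; rewrite !mxE; under eq_bigr do rewrite mxE !nilp_blockX.
  have [lt|ge] := ltnP i (m - k).
    have lt' : (i + k < m)%N by lia.
    rewrite (bigD1 (Ordinal lt')) //= eqxx mul1r eqn_add2r andbT.
    rewrite big1 ?addr0 ?[_ == val i]eq_sym // => l ne.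
    by case: eqP => [E|]; rewrite ?mul0r //; case/eqP: ne; apply/val_inj.
  rewrite andbF big1 // => l _.
  by case: eqP => [E|]; rewrite ?mul0r //; have := ltn_ord l; lia.
by rewrite -(rank_pid_mx F (leq_subr k m) (leq_subr k m)) -DD mxrankM_maxl.
Qed.

Lemma mxdiagX s (p_ : 'I_s -> nat) (B_ : forall i, 'M[F]_(p_ i)) k :
  (\mxdiag_i B_ i) ^+ k = \mxdiag_i (B_ i ^+ k).
Proof.
elim: k => [|k IHk].
  rewrite expr0 -[1]/(1%:M) -mxdiagZ; apply: eq_mxdiag => i; exact: expr0.
rewrite exprS IHk -mulmxE mul_mxdiag_mxblock; apply/eq_mxblock => i j.
by case: eqP => [->|]; rewrite ?mulmx0 // !conform_mx_id exprS mulmxE.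
Qed.

Lemma rank_jordan_mxX lam k :
  \rank (jordan_mx F lam ^+ k) = sumn [seq (x - k)%N | x <- lam].
Proof.
rewrite mxdiagX rank_mxdiag; under eq_bigr do rewrite rank_nilp_blockX.
by rewrite sumnE big_map (big_nth 0%N) big_mkord.
Qed.

Lemma jordan_mx_cons l lam :
  mxsimilar (jordan_mx F (l :: lam)) (block_mx (nilp_block F l) 0 0 (jordan_mx F lam)).
Proof. rewrite /jordan_mx mxdiag_recl; exact: mxsimilar_castmx. Qed.

End Similarity.

(** * Existence of the Jordan form of a nilpotent matrix *)

Section JordanExistence.
Variable F : fieldType.

(** If [A ^ (L + 1) = 0] and the entry [(i, j)] of [A ^ L] is nonzero, the rows
    [e_i A ^ a] span a cyclic summand.  An [A]-stable complement is the common
    kernel of the functionals [x |-> (x A ^ c)_j], because the pairing of these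
    rows with these functionals is triangular with nonzero diagonal. *)
Section CyclicSummand.
Variables (n L : nat) (A : 'M[F]_n) (i j : 'I_n).
Hypotheses (AL1 : A ^+ L.+1 = 0) (ALij : (A ^+ L) i j != 0).

Let AX0 k : (L < k)%N -> A ^+ k = 0.
Proof. by move=> lt; rewrite -(subnK lt) exprD AL1 mulr0. Qed.

Let G : 'M[F]_(L.+1, n) := \matrix_(a, b) (A ^+ a) i b.
Let Phi : 'M[F]_(n, L.+1) := \matrix_(b, c) (A ^+ (L - c)) b j.

Lemma chain_stable : G *m A = nilp_block F L.+1 *m G.
Proof.
apply/matrixP => a b; rewrite !mxE.
have -> : \sum_k G a k * A k b = (A ^+ a.+1) i b.
  by rewrite exprSr -mulmxE [RHS]mxE; apply: eq_bigr => k _; rewrite mxE.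
have [lt|ge] := ltnP a L.
  rewrite (bigD1 (Ordinal (lt : (a.+1 < L.+1)%N))) //= !mxE eqxx mul1r.
  rewrite big1 ?addr0 // => k ne.
  rewrite mxE; case: eqP => [E|]; rewrite ?mul0r //; case/eqP: ne.
  exact/val_inj.
rewrite AX0 // mxE big1 // => k _; rewrite mxE.
by case: eqP => [E|]; rewrite ?mul0r //; have := ltn_ord k; lia.
Qed.

Lemma cochain_stable : A *m Phi = Phi *m nilp_block F L.+1.
Proof.
apply/matrixP => b c; rewrite !mxE.
have -> : \sum_k A b k * Phi k c = (A ^+ (L - c).+1) b j.
  by rewrite exprS -mulmxE [RHS]mxE; apply: eq_bigr => k _; rewrite mxE.
case: c => -[|c] lt /=.
  by rewrite subn0 AL1 mxE big1 // => k _; rewrite !mxE mulr0.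
rewrite (bigD1 (Ordinal (ltnW lt))) //= !mxE eqxx mulr1 big1 ?addr0.
  by rewrite /= subnSK.
move=> k ne; rewrite !mxE; case: eqP => [[E]|]; rewrite ?mulr0 //.
by case/eqP: ne; apply/val_inj.
Qed.

Lemma chain_pairing_unit : G *m Phi \in unitmx.
Proof.
have E a c : (G *m Phi) a c = (A ^+ (a + (L - c))) i j.
  by rewrite exprD -mulmxE !mxE; apply: eq_bigr => k _; rewrite !mxE.
rewrite unitmxE -det_tr det_trig.
  rewrite unitfE; apply/prodf_neq0 => a _; rewrite mxE E subnKC //.
  exact: leq_ord.
apply/is_trig_mxP => a c lt; rewrite mxE E AX0 ?mxE //.
by have := ltn_ord c; have := ltn_ord a; lia.
Qed.

Lemma split_cyclic_summand :
  exists (w : nat) (B : 'M[F]_w),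
    B ^+ L.+1 = 0 /\ mxsimilar (block_mx (nilp_block F L.+1) 0 0 B) A.
Proof.
(* [B] is the matrix of the restriction of [A] to the complement [W]. *)
pose W := row_base (kermx Phi); pose B := W *m A *m pinvmx W.
have BW : B *m W = W *m A.
  apply: mulmxKpV; rewrite eq_row_base; apply/sub_kermxP.
  rewrite -mulmxA cochain_stable mulmxA (_ : W *m Phi = 0) ?mul0mx //.
  by apply/sub_kermxP; rewrite eq_row_base.
exists (\rank (kermx Phi)), B; split.
  apply: (row_free_inj (row_base_free (kermx Phi))).
  by rewrite /= -(mxsimilar_exp _ (esym BW)) AL1 mulmx0 mul0mx.
have full : row_full (col_mx G W).
  (* [C *m G] is the projection onto the cyclic summand along [W]. *)
  rewrite -sub1mx -addsmxE; pose C := Phi *m invmx (G *m Phi).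
  rewrite -[1%:M](subrK (C *m G)) addrC addmx_sub_adds ?submxMl //.
  rewrite eq_row_base; apply/sub_kermxP.
  rewrite mulmxBl mul1mx /C -!mulmxA [invmx _ *m _]mulVmx ?mulmx1 ?subrr //.
  exact: chain_pairing_unit.
have rPhi : \rank Phi = L.+1.
  apply/eqP; rewrite eqn_leq rank_leq_col /=.
  by rewrite -{1}(mxrank_unit chain_pairing_unit) mxrankM_maxr.
exists (col_mx G W); split=> //.
  rewrite /row_free (eqP full) mxrank_ker rPhi subnKC // -rPhi.
  exact: rank_leq_row.
by rewrite mul_col_mx mul_block_col !mul0mx addr0 add0r BW chain_stable.
Qed.

End CyclicSummand.

(** Splitting off a cyclic summand of maximal size keeps the list of block sizes
    sorted: the complement is killed by the same power of [A], which is why the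
    induction also bounds the parts. *)
Lemma nilpotent_jordan_form n k (A : 'M[F]_n) : A ^+ k = 0 ->
  exists lam, [/\ is_partition n lam, all (geq k) lam &
                  mxsimilar (jordan_mx F lam) A].
Proof.
have [N] := ubnP n; elim: N => // N IHN in n k A * => ltn Ak.
have [n0|n_gt0] := posnP n.
  move: A Ak; rewrite n0 => A _; exists [::]; split=> //.
  have e0 : (\sum_(i < size (@nil nat)) nth 0 [::] i = 0)%N by rewrite big_ord0.
  rewrite /jordan_mx; move: (\mxdiag_i _); rewrite e0 => M.
  exists 1%:M; split; rewrite ?row_free_unit ?row_full_unit ?unitmx1 //.
  by rewrite [LHS]flatmx0 [RHS]flatmx0.
have exA : exists k, A ^+ k == 0 by exists k; apply/eqP.
case: (ex_minnP exA) => -[|L] /eqP AL minL.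
  case: n n_gt0 {ltn} => // n _ in A AL {Ak exA minL} *.
  by move/eqP: AL; rewrite expr0 oner_eq0.
have /matrix0Pn[i [j ALij]] : A ^+ L != 0.
  by apply/negP => /minL; rewrite ltnn.
have [w [B [BL simB]]] := split_cyclic_summand AL ALij.
have nE : (L.+1 + w)%N = n by exact: mxsimilar_size simB.
have [||mu [/and3P[srt pos /eqP sm] le simmu]] := IHN w L.+1 B.
- by rewrite -nE in ltn; lia.
- exact: BL.
have leLk : (L < k)%N by apply: minL; apply/eqP.
exists (L.+1 :: mu); split.
- rewrite /is_partition /= pos sm nE eqxx !andbT.
  by rewrite (path_sortedE (rev_trans leq_trans)) le.
- by rewrite /= leLk; apply: sub_all le => x /= /leq_trans; apply.
- apply: mxsimilar_trans (mxsimilar_trans (mxsimilar_block _ simmu) simB).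
  exact: jordan_mx_cons.
Qed.

End JordanExistence.

(** * The column profile of a matrix and its bordering by a row *)

Section ColumnProfile.
Variable F : fieldType.

Definition jordan_col n (A : 'M[F]_n) (k : nat) : nat :=
  (\rank (A ^+ k) - \rank (A ^+ k.+1))%N.

Lemma leq_rankX n (A : 'M[F]_n) k : (\rank (A ^+ k.+1) <= \rank (A ^+ k))%N.
Proof. by rewrite exprS -mulmxE mxrankM_maxr. Qed.

Lemma jordan_col_mxsimilar n (A : 'M[F]_n) lam :
  mxsimilar (jordan_mx F lam) A ->
  jordan_col A =1 parts_gt lam.
Proof.
move=> sim k; rewrite /jordan_col /parts_gt -!(mxsimilar_rank _ sim) !rank_jordan_mxX.
apply/eqP; rewrite -(eqn_add2r (sumn [seq (x - k.+1)%N | x <- lam])) subnK.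
  by apply/eqP; elim: lam {sim} => //= x lam ->; lia.
by elim: lam {sim} => //= x lam; lia.
Qed.

Lemma partition_parts_gt_inj n n' lam mu :
    is_partition n lam -> is_partition n' mu ->
    parts_gt lam =1 parts_gt mu ->
  lam = mu.
Proof.
have cnt s k : count_mem k.+1 s = (parts_gt s k - parts_gt s k.+1)%N.
  rewrite /parts_gt; elim: s => //= x s ->.
  have := @sub_count _ (fun x => k.+1 < x)%N (fun x => k < x)%N.
  move=> /(_ (fun x lt => ltnW lt) s).
  by case: (ltngtP k.+1 x) => h; case: (eqVneq x k.+1) => h'; lia.
have z s : all (leq 1) s -> count_mem 0%N s = 0%N.
  by elim: s => //= x s IHs /andP[x_gt0 /IHs->]; rewrite addn0 gtn_eqF.
move=> /and3P[srt pos _] /and3P[srt' pos' _] E.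
apply: (sorted_eq (rev_trans leq_trans) _ srt srt').
  by move=> x y /andP[]; rewrite /= => h h'; apply/eqP; rewrite eqn_leq h h'.
apply/allP => -[|k] _ /=; last by rewrite !cnt !E.
by rewrite /= !z.
Qed.

Definition border n (u : 'rV[F]_n) (A : 'M[F]_n) : 'M[F]_n.+1 :=
  block_mx (0 : 'M_1) u 0 A.

Lemma borderX n (u : 'rV[F]_n) A k :
  border u A ^+ k.+1 = block_mx (0 : 'M_1) (u *m A ^+ k) 0 (A ^+ k.+1).
Proof.
elim: k => [|k IHk]; first by rewrite !expr1 expr0 mulmx1.
rewrite exprSr IHk [LHS](@mulmx_block _ 1 n 1 n 1 n).
by rewrite !(mulmx0, mul0mx, addr0, add0r) -mulmxA mulmxE -!exprSr.
Qed.

(** The rows [u] for which the bordered matrix and [A] have powers of exponent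
    [k + 1] of the same rank ([rank_borderX]). *)
Definition level_space n (A : 'M[F]_n) k : 'M[F]_n := (A + kermx (A ^+ k))%MS.

Lemma sub_level_space n (A : 'M[F]_n) (u : 'rV_n) k :
  (u <= level_space A k)%MS = (u *m A ^+ k <= A ^+ k.+1)%MS.
Proof.
apply/sub_addsmxP/submxP => [[[x y] /= ->] | [x E]].
  exists x.
  by rewrite mulmxDl -(mulmxA y) mulmx_ker mulmx0 addr0 -(mulmxA x) exprS.
exists (x, (u - x *m A) *m pinvmx (kermx (A ^+ k))) => /=.
rewrite mulmxKpV; first by rewrite addrC subrK.
by apply/sub_kermxP; rewrite mulmxBl E -mulmxA exprS subrr.
Qed.

Lemma rank_adds_rV m n (v : 'rV[F]_n) (B : 'M[F]_(m, n)) :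
  \rank (v + B)%MS = (\rank B + ~~ (v <= B)%MS)%N.
Proof.
have [le|nle] := boolP (v <= B)%MS.
  by rewrite addn0; apply/eqmx_rank/eqmxP/addsmx_idPr.
have lt : (\rank (v :&: B) < \rank v)%N.
  rewrite (ltn_leqif (mxrank_leqif_sup (capmxSl v B))).
  by apply: contra nle => /submx_trans-> //; exact: capmxSr.
have := mxrank_sum_cap v B; have := rank_leq_row v; lia.
Qed.

Lemma rank_borderX n (u : 'rV[F]_n) (A : 'M[F]_n) k :
  \rank (border u A ^+ k.+1) =
    (\rank (A ^+ k.+1) + ~~ (u <= level_space A k)%MS)%N.
Proof.
rewrite borderX block_mxEh col_mx0 sub_level_space -rank_adds_rV addsmxE.
exact: (@rank_row_0mx F (1 + n) n 1 _).
Qed.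

Lemma level_spaceS n (A : 'M[F]_n) k :
  (level_space A k <= level_space A k.+1)%MS.
Proof.
apply: addsmxS => //; apply/sub_kermxP.
by rewrite exprSr -mulmxE mulmxA mulmx_ker mul0mx.
Qed.

Lemma level_space_mono n (A : 'M[F]_n) i k : (i <= k)%N ->
  (level_space A i <= level_space A k)%MS.
Proof.
move/subnK<-; elim: (k - i)%N => // d /submx_trans-> //; exact: level_spaceS.
Qed.

(** The intersection of [im A] with [ker (A ^ k)] has dimension
    [rank A - rank (A ^ (k + 1))]. *)
Lemma rank_level_space n (A : 'M[F]_n) k :
  (\rank (level_space A k) + jordan_col A k)%N = n.
Proof.
have := mxrank_sum_cap A (kermx (A ^+ k)); rewrite -/(level_space A k).
have := mxrank_mul_ker A (A ^+ k); rewrite mulmxE -exprS mxrank_ker.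
have := leq_rankX A k; have := rank_leq_row (A ^+ k); rewrite /jordan_col; lia.
Qed.

(** The level spaces increase with [k], so their codimensions decrease. *)
Lemma jordan_col_anti n (A : 'M[F]_n) k :
  (jordan_col A k.+1 <= jordan_col A k)%N.
Proof.
have := mxrankS (level_spaceS A k).
have := rank_level_space A k; have := rank_level_space A k.+1; lia.
Qed.

(** The level spaces form a flag, hence [j] is the least index of a level space
    containing [u]; it is the column that receives the new box. *)
Definition has_level n (A : 'M[F]_n) (u : 'rV[F]_n) (j : nat) : bool :=
  (u <= level_space A j)%MS &&
  (if j is i.+1 then ~~ (u <= level_space A i)%MS else true).

Lemma has_levelE n (A : 'M[F]_n) u j k :
  has_level A u j -> (u <= level_space A k)%MS = (j <= k)%N.
Proof.
case/andP=> le nle; have [lejk|ltkj] := leqP j k.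
  exact: submx_trans le (level_space_mono _ lejk).
case: j ltkj nle {le} => // i; rewrite ltnS => leki; apply: contraNF => le.
exact: submx_trans le (level_space_mono _ leki).
Qed.

Lemma has_level_exists n (A : 'M[F]_n) u m :
  A ^+ m = 0 -> exists j, has_level A u j.
Proof.
move=> A0; have ex : exists j, (u <= level_space A j)%MS.
  exists m; rewrite sub_level_space A0 mulmx0; exact: sub0mx.
case: (ex_minnP ex) => j le min; exists j; rewrite /has_level le.
case: j {le} min => // j min; apply/negP => /min; by rewrite ltnn.
Qed.

Lemma jordan_col_border n (A : 'M[F]_n) u j k : has_level A u j ->
  jordan_col (border u A) k = (jordan_col A k + (k == j))%N.
Proof.
move=> lev.
have rk i : \rank (border u A ^+ i) = (\rank (A ^+ i) + (i <= j))%N.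
  case: i => [|i]; first by rewrite !expr0 !mxrank1 addn1.
  by rewrite rank_borderX (has_levelE _ lev) -ltnNge.
rewrite /jordan_col !rk; have := leq_rankX A k.
by case: (ltngtP k j) => h; case: (ltngtP k.+1 j) => h'; lia.
Qed.

End ColumnProfile.

(** * Strictly upper triangular matrices as iterated borderings *)

Section StrictlyUpper.
Variable F : fieldType.

Lemma strictly_upper_border n (u : 'rV[F]_n) (A : 'M[F]_n) :
  strictly_upper (border u A) = strictly_upper A.
Proof.
apply/'forall_'forall_implyP/'forall_'forall_implyP => /= H i j.
  move=> le; have := H (rshift 1 i) (rshift 1 j).
  by rewrite [border u A _ _]block_mxEdr; apply; rewrite !leq_add2l.
case: (@split_ordP 1 n i) => i' ->; case: (@split_ordP 1 n j) => j' -> /=.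
- by rewrite [border u A _ _]block_mxEul mxE.
- by rewrite (ord1 i').
- by rewrite [border u A _ _]block_mxEdl mxE.
- by rewrite [border u A _ _]block_mxEdr leq_add2l; apply: H.
Qed.

Lemma strictly_upperE n (A : 'M[F]_n.+1) : strictly_upper A ->
  border (ursubmx (A : 'M_(1 + n))) (drsubmx (A : 'M_(1 + n))) = A.
Proof.
move=> /'forall_'forall_implyP H; rewrite -[RHS](@submxK _ 1 n 1 n).
rewrite /border; congr (@block_mx F 1 n 1 n _ _ _ _).
all: apply/matrixP => i j; rewrite !mxE; apply/esym/eqP/H.
  by rewrite (ord1 i) (ord1 j).
by rewrite (ord1 j).
Qed.

Lemma strictly_upper_nilpotent n (A : 'M[F]_n) : strictly_upper A -> A ^+ n = 0.
Proof.
elim: n A => [|n IHn] A su; first exact: flatmx0.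
move: (su); rewrite -(strictly_upperE su) strictly_upper_border => /IHn A0.
rewrite borderX exprS A0 mulmx0 mulr0; exact: (@block_mx0 _ 1 n 1 n).
Qed.

Lemma jordan_col_ge n (A : 'M[F]_n) m k :
  A ^+ m = 0 -> (m <= k)%N -> jordan_col A k = 0%N.
Proof.
by move=> A0 le; rewrite /jordan_col -(subnK le) exprD A0 mulr0 mxrank0.
Qed.

End StrictlyUpper.

(** * Counting strictly upper triangular matrices by column profile *)

Definition remove_box (c : nat -> nat) (j k : nat) : nat := (c k - (k == j))%N.

Section ColumnCount.
Variables (F : finFieldType) (K : nat).

(** Only finitely many columns are compared, so that this is a boolean.  For a
    profile supported on the first [K] columns this loses nothing, since the
    profile of a nilpotent matrix of size [n] vanishes from column [n] on. *)
Definition has_cols n (A : 'M[F]_n) (c : nat -> nat) : bool :=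
  strictly_upper A && [forall k : 'I_(K + n), jordan_col A k == c k].

Definition col_count n (c : nat -> nat) : nat :=
  #|[set A : 'M[F]_n | has_cols A c]|.

Lemma has_colsP n (A : 'M[F]_n) c :
  (forall k, (K <= k)%N -> c k = 0%N) ->
  reflect (strictly_upper A /\ jordan_col A =1 c) (has_cols A c).
Proof.
move=> supp; apply: (iffP andP) => -[su H]; split=> //; last first.
  by apply/forallP => k; rewrite H.
move=> k; have [lt|le] := ltnP k (K + n).
  exact/eqP/(forallP H (Ordinal lt)).
rewrite supp ?(leq_trans (leq_addr _ _) le) //.
apply: jordan_col_ge (strictly_upper_nilpotent su) _.
exact: leq_trans (leq_addl _ _) le.
Qed.

Lemma remove_box_supp c j : (forall k, (K <= k)%N -> c k = 0%N) ->
  forall k, (K <= k)%N -> remove_box c j k = 0%N.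
Proof. by move=> supp k le; rewrite /remove_box supp. Qed.

(** At most one summand is nonzero: the level of [u] determines [j]. *)
Lemma has_cols_border n (A : 'M[F]_n) u c :
  (forall k, (K <= k)%N -> c k = 0%N) -> strictly_upper A ->
  (has_cols (border u A) c : nat) =
    (\sum_(j < K | (0 < c j)%N) (has_cols A (remove_box c j) && has_level A u j))%N.
Proof.
move=> supp su.
have suppr j := remove_box_supp j supp.
have [j0 lev0] := has_level_exists u (strictly_upper_nilpotent su).
have uniq_lev j : has_level A u j -> j = j0.
  move=> lev; apply/eqP; rewrite eqn_leq.
  rewrite -(has_levelE j0 lev) -(has_levelE j lev0).
  by case/andP: lev => -> _; case/andP: lev0 => ->.
case: (has_colsP _ supp) => [[_ cE]|H]; last first.
  apply/esym/eqP; rewrite sum_nat_eq0; apply/forall_inP => j cj.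
  rewrite eqb0; apply/negP => /andP[/(has_colsP A (suppr j))[_ cE] lev]; case: H; split.
    by rewrite strictly_upper_border.
  move=> k; rewrite (jordan_col_border _ lev) cE /remove_box.
  by case: eqP => [->|]; rewrite ?subnK ?addn0 ?subn0.
have c0 : (0 < c j0)%N by rewrite -cE (jordan_col_border _ lev0) eqxx addn1.
have lt : (j0 < K)%N by rewrite ltnNge; apply: contraL c0 => /supp->.
rewrite (bigD1 (Ordinal lt)) //= big1 => [|j /andP[_ ne]]; last first.
  case lev: (has_level A u j); rewrite ?andbF //.
  by case/eqP: ne; apply/val_inj/uniq_lev.
rewrite lev0 andbT addn0; case: (has_colsP A (suppr j0)) => // -[]; split=> // k.
by rewrite /remove_box -cE (jordan_col_border _ lev0) addnK.
Qed.

Lemma card_has_level n (A : 'M[F]_n) j :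
  #|[set u | has_level A u j]| =
    (#|F| ^ (n - jordan_col A j) -
      (if j is i.+1 then #|F| ^ (n - jordan_col A i) else 0))%N.
Proof.
have rk k : (n - jordan_col A k)%N = \rank (level_space A k).
  by rewrite -[X in (X - _)%N](rank_level_space A k) addnK.
rewrite rk -card_rowg; case: j => [|i].
  by rewrite subn0; apply: eq_card => u; rewrite !inE /has_level andbT.
rewrite rk -card_rowg.
have /setIidPr E : rowg (level_space A i) \subset rowg (level_space A i.+1).
  by rewrite rowgS level_spaceS.
rewrite -[in RHS]E -cardsD; apply: eq_card => u.
by rewrite !inE andbC.
Qed.

(** A box in column [j] can only be removed when column [j + 1] is strictly
    shorter: profiles of matrices are nonincreasing, so otherwise the count for
    [remove_box c j] is zero. *)
Lemma col_countS n c :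
  (forall k, (K <= k)%N -> c k = 0%N) ->
  col_count n.+1 c = (\sum_(j < K | c j.+1 < c j)
    col_count n (remove_box c j) *
    (#|F| ^ (n - (c j).-1) - (if val j is i.+1 then #|F| ^ (n - c i) else 0)))%N.
Proof.
move=> supp; have suppr j := remove_box_supp j supp.
pose h (p : 'M[F]_n * 'rV[F]_n) := border p.2 p.1.
pose h' (B : 'M[F]_n.+1) := (drsubmx (B : 'M_(1 + n)), ursubmx (B : 'M_(1 + n))).
have hK p : h' (h p) = p.
  by rewrite /h' /h /border block_mxKdr block_mxKur -surjective_pairing.
transitivity (\sum_(A : 'M[F]_n | strictly_upper A)
                \sum_u (has_cols (border u A) c : nat))%N.
  rewrite /col_count -sum1dep_card (reindex_onto h h') => [|B /andP[su _]]; last first.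
    exact: strictly_upperE.
  rewrite pair_big_dep /= [RHS]big_mkcond /= big_mkcond /=; apply: eq_bigr => -[A u] _.
  rewrite hK eqxx andbT /h /=.
  rewrite andbT /has_cols strictly_upper_border.
  by case: (strictly_upper A) => //=; case: [forall _, _].
transitivity (\sum_(j < K | (0 < c j)%N) \sum_(A : 'M[F]_n | has_cols A (remove_box c j))
   #|[set u | has_level A u j]|)%N.
  under eq_bigr => A su.
    under eq_bigr do rewrite (has_cols_border _ supp su).
    rewrite exchange_big /=; over.
  rewrite exchange_big /=; apply: eq_bigr => j _.
  rewrite [RHS]big_mkcond [LHS]big_mkcond /=; apply: eq_bigr => A _.
  case: ifP => su; last by rewrite /has_cols su.
  case: ifP => _; last by rewrite big1.
  by rewrite -sum1dep_card [RHS]big_mkcond.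
rewrite big_mkcond [RHS]big_mkcond /=; apply: eq_bigr => j _.
case: ltnP => [c_gt0|]; last by rewrite leqn0 => /eqP->.
transitivity (\sum_(A : 'M[F]_n | has_cols A (remove_box c j))
    if (c j.+1 < c j)%N then
    (#|F| ^ (n - (c j).-1) - (if val j is i.+1 then #|F| ^ (n - c i) else 0)) else 0)%N.
  apply: eq_bigr => A /(has_colsP A (suppr j))[su cE].
  rewrite card_has_level cE {1}/remove_box eqxx subn1.
  have -> : (c j.+1 < c j)%N.
    have := jordan_col_anti A j; rewrite !cE /remove_box eqxx.
    by rewrite -[X in (_ <= _ - X)%N]/(1%N) gtn_eqF //; lia.
  case: j c_gt0 cE => -[|i] //= _ _ cE.
  by rewrite cE /remove_box ltn_eqF ?subn0.
rewrite sum_nat_const /col_count; case: ifP => // _; last by rewrite muln0.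
by congr (_ * _)%N; apply: eq_card => A; rewrite inE.
Qed.

End ColumnCount.

(** * The normalised counting polynomials *)

Definition qnum (k : nat) : {poly int} := \sum_(i < k) 'X^i.

(** With [b] the first column and [t] the remaining ones, this is the full
    profile.  The value [b = 0] is also used, to treat the empty column to the
    left of [t] uniformly. *)
Definition ccons (b : nat) (t : nat -> nat) (k : nat) : nat :=
  if k is i.+1 then t i else b.

Section StablePoly.
Variable K : nat.

(** The columns of a partition other than the first one, [m] boxes in all. *)
Definition is_tail (m : nat) (t : nat -> nat) : Prop :=
  [/\ forall k, (t k.+1 <= t k)%N, forall k, (K <= k)%N -> t k = 0%N &
      (\sum_(k < K) t k = m)%N].

(** The solution of [f b = 'X^s * f (b - 1) + G b] with [f b = G b] for [b <= s];
    the first summand is the removal of a box from the first column. *)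
Fixpoint add_ones (s : nat) (G : nat -> {poly int}) (b : nat) : {poly int} :=
  (if b is b'.+1 then if (s <= b')%N then 'X^s * add_ones s G b' else 0 else 0)
  + G b.

(** The count for the profile [ccons b t], divided by its powers of [q - 1] and
    by [q ^ (b * (m - t 0))].  The latter is the part of the power of [q] that
    grows with [b], and removing it makes all exponents of ['X] below
    independent of [b]. *)
Fixpoint stab_poly (m : nat) (t : nat -> nat) : nat -> {poly int} :=
  if m is m'.+1 then
    add_ones (t 0%N) (fun b => \sum_(j < K | (t j.+1 < t j)%N)
      'X^(m' - ccons 0 t j) * qnum (ccons b t j - t j).+1
        * stab_poly m' (remove_box t j) b)
  else fun _ => 1.

Lemma is_tail_leq m t i : is_tail m t -> (t i <= m)%N.
Proof.
move=> [anti supp <-]; have [lt|/supp->//] := ltnP i K.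
by rewrite (bigD1 (Ordinal lt)) //= leq_addr.
Qed.

Lemma is_tail_leq2 m t i j : is_tail m t -> (i < j)%N -> (t i + t j <= m)%N.
Proof.
move=> tl ltij; have := is_tail_leq i tl.
have [anti supp E] := tl; have [lt|/supp->] := ltnP j K; last by rewrite addn0.
move=> _; rewrite -E (bigD1 (Ordinal (ltn_trans ltij lt))) //= leq_add2l.
rewrite (bigD1 (Ordinal lt)) //= ?leq_addr //.
by apply/eqP => -[E']; rewrite E' ltnn in ltij.
Qed.

Lemma is_tail_remove m t j :
  is_tail m.+1 t -> (t j.+1 < t j)%N -> is_tail m (remove_box t j).
Proof.
move=> [anti supp E] corner; split.
- move=> k; rewrite /remove_box; have := anti k.
  by case: eqP => [->|_]; case: eqP => [E'|_] //=; rewrite -?E' in corner *; lia.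
- exact: remove_box_supp.
have lt : (j < K)%N by rewrite ltnNge; apply/negP => /supp E'; rewrite E' in corner.
move: E; rewrite (bigD1 (Ordinal lt)) //= [in RHS]/= => E.
rewrite (bigD1 (Ordinal lt)) //= {1}/remove_box eqxx.
rewrite (eq_bigr (fun k : 'I_K => t k)) => [|k ne]; last first.
  by rewrite /remove_box (_ : (k == j :> nat) = false) ?subn0 //; apply/eqP => E';
     case/eqP: ne; apply/val_inj.
lia.
Qed.

(** Without a removable box, [t] would be constant up to column [K], where it
    vanishes. *)
Lemma is_tail_corner m t : is_tail m.+1 t -> exists j : 'I_K, (t j.+1 < t j)%N.
Proof.
move=> [anti supp E]; 
have [/existsP//|/existsPn H] := boolP [exists j : 'I_K, (t j.+1 < t j)%N].
have t0 d : t (K - d)%N = 0%N.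
  elim: d => [|d IHd]; first by rewrite supp ?subn0.
  have [lt|le] := ltnP d K; last by rewrite -IHd; congr t; lia.
  have lt' : (K - d.+1 < K)%N by lia.
  have := H (Ordinal lt'); rewrite /= -leqNgt subnSK // IHd leqn0.
  by move/eqP.
move: E; rewrite big1 // => k _; rewrite -(t0 (K - k)%N) subKn //.
exact: ltnW.
Qed.

Lemma qnum_geometric k : ('X - 1) * qnum k = 'X^k - 1.
Proof. by rewrite subrX1. Qed.

Lemma eq_has_cols (F : finFieldType) n (A : 'M[F]_n) K' c c' :
  c =1 c' -> has_cols K' A c = has_cols K' A c'.
Proof.
by move=> E; congr andb; apply/eq_forallb => k; rewrite E.
Qed.

Lemma eq_col_count (F : finFieldType) K' n c c' :
  c =1 c' -> col_count F K' n c = col_count F K' n c'.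
Proof.
by move=> E; apply: eq_card => A; rewrite !inE (eq_has_cols _ _ E).
Qed.

Lemma ccons_supp b t :
  (forall k, (K <= k)%N -> t k = 0%N) ->
  forall k, (K.+1 <= k)%N -> ccons b t k = 0%N.
Proof. by move=> supp [|k] //= /supp. Qed.

(** Both sides satisfy the same recursion.  Removing a box from column [j] of
    [t] produces [q ^ x - q ^ y = q ^ y * (q - 1) * [x - y]], where [x - y] is one
    more than the difference of the lengths of two neighbouring columns; the
    remaining work is to match the exponents of [q]. *)
Lemma col_count_stab (F : finFieldType) m t b :
  is_tail m t -> (t 0%N <= b)%N ->
  (col_count F K.+1 (b + m) (ccons b t))%:R =
    ('X^(b * (m - t 0%N)) * ('X - 1) ^+ m * stab_poly m t b).[#|F|%:R] :> int.
Proof.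
set q := #|F|%:R : int.
have qX e : (#|F| ^ e)%N%:R = q ^+ e by rewrite natrX.
elim: m => [|m IHm] in t b *.
  move=> tl leb; have [_ supp _] := tl.
  have t0 k : t k = 0%N by apply/eqP; rewrite -leqn0 (is_tail_leq k tl).
  rewrite !addn0 t0 muln0 !expr0 !mulr1 hornerC.
  rewrite /col_count (_ : [set A | _] = [set (0 : 'M[F]_b)]) ?cards1 //.
  apply/setP => A; rewrite !inE.
  apply/(has_colsP _ (ccons_supp b supp))/eqP => [[_ /(_ 0%N)]|->].
    rewrite /jordan_col expr0 expr1 mxrank1 /= => E.
    apply/eqP; rewrite -mxrank_eq0; have := rank_leq_row A; lia.
  split; first by apply/'forall_'forall_implyP => i j _; rewrite mxE.
  by case=> [|k]; rewrite /jordan_col !expr0n ?mxrank1 !mxrank0 /= ?t0 ?subn0.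
(* The term of [col_countS] for a box in column [j + 1] of the full profile. *)
move: b; have tmove b j : is_tail m.+1 t -> (t j.+1 < t j)%N -> (t 0%N <= b)%N ->
    (col_count F K.+1 (b + m) (remove_box (ccons b t) j.+1)
      * (#|F| ^ (b + m - (t j).-1) - #|F| ^ (b + m - ccons b t j)))%:R =
    ('X^(b * (m.+1 - t 0%N)) * ('X - 1) ^+ m.+1 *
      ('X^(m - ccons 0 t j) * qnum (ccons b t j - t j).+1
        * stab_poly m (remove_box t j) b)).[q].
  move=> tl corner leb; have [anti supp _] := tl.
  have tl' := is_tail_remove tl corner.
  have lt0 := is_tail_leq 0 tl; have lt0' := is_tail_leq 0 tl'.
  have ltj1 := is_tail_leq2 tl (ltnSn j).
  have le_col : (t j <= ccons b t j)%N by case: (j) => //= i; exact: anti.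
  have le_bm : (ccons b t j <= b + m)%N.
    case: (j) corner => [|i] /= corner; first exact: leq_addr.
    by have := is_tail_leq2 tl (ltnSn i); lia.
  rewrite (@eq_col_count _ _ _ _ (ccons b (remove_box t j))); last first.
    by case=> [|k] //=; rewrite /remove_box subn0.
  rewrite natrM IHm //; last by rewrite /remove_box; lia.
  rewrite natrB; last first.
    rewrite leq_exp2l ?card_finNzRing_gt1 //; lia.
  rewrite !qX.
  rewrite (_ : _ - (t j).-1 = b + m - ccons b t j + (ccons b t j - t j).+1)%N;
    last by lia.
  have /(congr1 (horner^~ q)) := qnum_geometric (ccons b t j - t j).+1.
  rewrite !(hornerM, hornerD, hornerXn, hornerX, hornerN, hornerC) => geo.
  have -> y : q ^+ (y + (ccons b t j - t j).+1) - q ^+ y =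
      q ^+ y * ((q - 1) * (qnum (ccons b t j - t j).+1).[q]).
    by rewrite geo exprD mulrBr mulr1.
  rewrite !horner_exp !(hornerD, hornerN, hornerX, hornerC).
  have E : (b * (m - remove_box t j 0) + (b + m - ccons b t j) =
      b * (m.+1 - t 0%N) + (m - ccons 0 t j))%N.
    case: (j) le_bm corner => [|i] /= le_bm corner.
      rewrite /remove_box eqxx subn0 addKn; congr (b * _ + _)%N; lia.
    rewrite {1}/remove_box subn0; have := is_tail_leq2 tl (ltn0Sn i).
    have := is_tail_leq2 tl (ltnSn i) => h1 h2.
    have -> : (m.+1 - t 0 = (m - t 0).+1)%N by lia.
    rewrite mulnS; lia.
  transitivity (q ^+ (b * (m - remove_box t j 0) + (b + m - ccons b t j))
    * (q - 1) ^+ m.+1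
    * (qnum (ccons b t j - t j).+1).[q] * (stab_poly m (remove_box t j) b).[q]).
    by rewrite exprD exprS; ring.
  by rewrite E exprD; ring.
move=> b tl; have [anti supp _] := tl; move: b.
(* The recursion of [col_countS], with the box in the first column apart. *)
have step b : (t 0%N <= b)%N ->
    (col_count F K.+1 (b + m.+1) (ccons b t))%:R =
    (if b is b'.+1 then if (t 0%N <= b')%N then
       (col_count F K.+1 (b' + m.+1) (ccons b' t) * #|F| ^ m.+1)%N%:R else 0 else 0)
    + \sum_(j < K | (t j.+1 < t j)%N) ('X^(b * (m.+1 - t 0%N)) * ('X - 1) ^+ m.+1 *
      ('X^(m - ccons 0 t j) * qnum (ccons b t j - t j).+1
        * stab_poly m (remove_box t j) b)).[q].
  move=> leb; rewrite addnS (col_countS _ _ (ccons_supp b supp)).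
  rewrite big_mkcond big_ord_recl /=.
  rewrite natrD; congr (_ + _).
    case: (b) leb => // b' leb'; rewrite ltnS; case: ifP => // le.
    rewrite subn0 (_ : b'.+1 + m - b' = m.+1)%N; last by lia.
    rewrite addSnnS; congr (_ * _)%:R; apply: eq_col_count => -[|k] //=.
      by rewrite /remove_box subn1.
    by rewrite /remove_box subn0.
  rewrite natr_sum [RHS]big_mkcond; apply: eq_bigr => j _.
  by rewrite -[bump _ _]/(val j).+1; case: ifP => // corner; exact: tmove.
elim=> [|b IHb] leb; rewrite step //= mulrDr hornerD mulr_sumr horner_sum.
  by rewrite mulr0 horner0.
congr (_ + _).
case: ifP => [le|_]; last by rewrite mulr0 horner0.
have lem := is_tail_leq 0 tl.
rewrite natrM qX IHb // mulrCA mulrA; set h := add_ones _ _ _.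
rewrite !(hornerM, hornerXn) !horner_exp !(hornerD, hornerN, hornerX, hornerC).
have E : (b * (m.+1 - t 0) + m.+1 = t 0 + b.+1 * (m.+1 - t 0))%N by lia.
transitivity (q ^+ (b * (m.+1 - t 0%N) + m.+1) * (q - 1) ^+ m.+1 * h.[q]).
  by rewrite exprD; ring.
by rewrite E exprD; ring.
Qed.
End StablePoly.

(** * Divisibility by powers of the variable and stability *)

Definition nneg_coef (p : {poly int}) : Prop := forall i, 0 <= p`_i.

Lemma nneg_coefD p p' : nneg_coef p -> nneg_coef p' -> nneg_coef (p + p').
Proof. by move=> nn nn' i; rewrite coefD addr_ge0. Qed.

Lemma nneg_coefM p p' : nneg_coef p -> nneg_coef p' -> nneg_coef (p * p').
Proof.
by move=> nn nn' i; rewrite coefM; apply: sumr_ge0 => j _; rewrite mulr_ge0.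
Qed.

Lemma nneg_coefXn k : nneg_coef 'X^k.
Proof. by move=> i; rewrite coefXn ler0n. Qed.

Lemma nneg_coef0 : nneg_coef 0.
Proof. by move=> i; rewrite coef0. Qed.

Definition xdvd (d : nat) (p : {poly int}) : Prop := exists S, p = 'X^d * S.

Definition nneg_xdvd (d : nat) (p : {poly int}) : Prop :=
  exists2 r, p = 'X^d * r & nneg_coef r.

(** A power of ['X] times a polynomial with nonnegative coefficients is tracked
    together with the exact order at 0, because nonnegativity is what prevents
    cancellation in sums. *)
Definition xval (d : nat) (p : {poly int}) : Prop :=
  exists r, [/\ p = 'X^d * r, nneg_coef r & 0 < r`_0].

Lemma xdvd0 d : xdvd d 0.
Proof. by exists 0; rewrite mulr0. Qed.

Lemma xdvdD d p p' : xdvd d p -> xdvd d p' -> xdvd d (p + p').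
Proof. by move=> [S ->] [S' ->]; exists (S + S'); rewrite mulrDr. Qed.

Lemma xdvd_sum I (s : seq I) (P : pred I) (p : I -> {poly int}) d :
  (forall i, P i -> xdvd d (p i)) -> xdvd d (\sum_(i <- s | P i) p i).
Proof. exact: (big_ind _ (xdvd0 d) (@xdvdD d)). Qed.

Lemma xdvdM d d' p p' : xdvd d p -> xdvd d' p' -> xdvd (d + d') (p * p').
Proof. by move=> [S ->] [S' ->]; exists (S * S'); rewrite exprD; ring. Qed.

Lemma xdvdXn d : xdvd d 'X^d.
Proof. by exists 1; rewrite mulr1. Qed.

Lemma xdvd_leq d d' p : (d <= d')%N -> xdvd d' p -> xdvd d p.
Proof.
move=> /subnKC<- [S ->]; exists ('X^(d' - d) * S); by rewrite mulrA -exprD.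
Qed.

Lemma xdvd_any p : xdvd 0 p.
Proof. by exists p; rewrite mul1r. Qed.

Lemma xval_nneg d p : xval d p -> nneg_xdvd d p.
Proof. by case=> r [-> nn _]; exists r. Qed.

Lemma xval_xdvd d p : xval d p -> xdvd d p.
Proof. by case=> r [-> _ _]; exists r. Qed.

Lemma nneg_xdvdD d p p' :
  nneg_xdvd d p -> nneg_xdvd d p' -> nneg_xdvd d (p + p').
Proof.
move=> [r -> nn] [r' -> nn']; exists (r + r'); first by rewrite mulrDr.
exact: nneg_coefD.
Qed.

Lemma nneg_xdvdXn e d p : nneg_xdvd d p -> nneg_xdvd d ('X^e * p).
Proof.
move=> [r -> nn]; exists ('X^e * r); first by rewrite mulrCA.
exact: nneg_coefM (nneg_coefXn _) nn.
Qed.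

Lemma nneg_xdvd_leq d d' p : (d <= d')%N -> nneg_xdvd d' p -> nneg_xdvd d p.
Proof.
move=> /subnKC<- [r -> nn]; exists ('X^(d' - d) * r); first by rewrite mulrA -exprD.
exact: nneg_coefM (nneg_coefXn _) nn.
Qed.

Lemma xvalD d p p' : xval d p -> nneg_xdvd d p' -> xval d (p + p').
Proof.
move=> [r [-> nn r0]] [r' -> nn']; exists (r + r'); split.
- by rewrite mulrDr.
- exact: nneg_coefD.
- by rewrite coefD ltr_wpDr //; exact: nn'.
Qed.

Lemma qnumE k : qnum k = \poly_(i < k) 1.
Proof. by rewrite poly_def; apply: eq_bigr => i _; rewrite scale1r. Qed.

Lemma qnumSr k : qnum k.+1 = qnum k + 'X^k.
Proof. by rewrite /qnum big_ord_recr. Qed.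

Lemma xval_qnum e k d p : xval d p -> xval (e + d) ('X^e * qnum k.+1 * p).
Proof.
move=> [r [-> nn r0]]; exists (qnum k.+1 * r); split.
- by rewrite exprD; ring.
- apply: nneg_coefM => // i; rewrite qnumE coef_poly.
  by case: ifP.
- by rewrite coef0M qnumE coef_poly /= mul1r.
Qed.

(** The terms of least order cannot cancel, having positive lowest
    coefficients. *)
Lemma xval_sum (I : finType) (P : pred I) (E : I -> nat) p i0 : P i0 ->
    (forall i, P i -> (E i0 <= E i)%N) -> (forall i, P i -> xval (E i) (p i)) ->
  xval (E i0) (\sum_(i | P i) p i).
Proof.
move=> Pi0 min val; rewrite (bigD1 i0) //=; apply: xvalD (val _ Pi0) _.
apply: (big_ind (nneg_xdvd (E i0))).
- by exists 0; [rewrite mulr0 | exact: nneg_coef0].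
- exact: nneg_xdvdD.
- by move=> i /andP[Pi _]; apply: nneg_xdvd_leq (min i Pi) _; apply/xval_nneg/val.
Qed.

Lemma add_ones_xval s G d :
  (forall b, (s <= b)%N -> xval d (G b)) ->
  forall b, (s <= b)%N -> xval d (add_ones s G b).
Proof.
move=> valG; elim=> [|b IHb] le /=; first by rewrite add0r; exact: valG.
rewrite addrC; apply: xvalD (valG _ le) _; case: ifP => [le'|_].
  exact/nneg_xdvdXn/xval_nneg/IHb.
by exists 0; [rewrite mulr0 | exact: nneg_coef0].
Qed.

(** The required order grows by one with each step of [b], and the recursion
    multiplies the previous difference by ['X^s] with [0 < s], which provides
    the missing factor.  At [b = s] there is no earlier difference, but
    ['X^s * f s] itself is divisible by ['X^(d + 1)]. *)
Lemma add_ones_stable s G d : (0 < s)%N ->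
  (forall b, (s <= b)%N -> xval d (G b)) ->
  (forall b, (s <= b)%N -> xdvd (d + (b - s).+1) (G b.+1 - G b)) ->
  forall b, (s <= b)%N ->
    xdvd (d + (b - s).+1) (add_ones s G b.+1 - add_ones s G b).
Proof.
move=> s_gt0 valG stabG b le.
rewrite [add_ones s G b.+1]/= le; set f := add_ones s G in stabG valG *.
have valf := add_ones_xval valG.
have prev : xdvd (d + (b - s).+1) ('X^s * f b - (f b - G b)).
  elim: b le => [|b IHb] le; first by rewrite leqn0 in le; rewrite (eqP le) in s_gt0.
  rewrite {2}/f /= addrK -/f; case: ifP => le'.
    rewrite -mulrBr.
    apply: (@xdvd_leq _ (s + (d + (b - s).+1))); first by rewrite subSn //; lia.
    apply: xdvdM (xdvdXn s) _.
    have -> : f b.+1 - f b = 'X^s * f b - (f b - G b) + (G b.+1 - G b).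
      by rewrite {1}/f /= le' -/f; ring.
    exact: xdvdD (IHb le') (stabG _ le').
  have -> : b.+1 = s by apply/eqP; rewrite eqn_leq le leqNgt ltnS le'.
  rewrite subr0 subnn addn1 -add1n; apply: xdvdM (xval_xdvd (valf _ (leqnn s))).
  exact: xdvd_leq s_gt0 (xdvdXn s).
have -> : 'X^s * f b + G b.+1 - f b = ('X^s * f b - (f b - G b)) + (G b.+1 - G b) by ring.
exact: xdvdD prev (stabG _ le).
Qed.

(** The order [d] is the least order of the terms for the removable boxes of
    [t].  In the difference, the term of a box outside column 0 is handled by
    induction alone; for a box in column 0 the [q]-integer also changes, by
    ['X^(b - t 0 + 1)], while the induction hypothesis gains one more factor. *)
Lemma stab_poly_stable K m t : is_tail K m t ->
  exists d, forall b, (t 0%N <= b)%N ->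
    xval d (stab_poly K m t b) /\
    xdvd (d + (b - t 0%N).+1) (stab_poly K m t b.+1 - stab_poly K m t b).
Proof.
elim: m t => [|m IHm] t tl.
  exists 0%N => b _ /=; split; last by rewrite subrr; exact: xdvd0.
  by exists 1; rewrite mulr1 coef1; split=> // i; rewrite coef1 ler0n.
have [anti supp _] := tl.
pose corner (j : 'I_K) := (t j.+1 < t j)%N.
have /fin_all_exists[d dP] : forall j : 'I_K, exists d, corner j ->
    forall b, (remove_box t j 0%N <= b)%N ->
    xval d (stab_poly K m (remove_box t j) b) /\
    xdvd (d + (b - remove_box t j 0%N).+1)
      (stab_poly K m (remove_box t j) b.+1 - stab_poly K m (remove_box t j) b).
  move=> j; case cj: (corner j); last by exists 0%N.
  by have [d dP] := IHm _ (is_tail_remove tl cj); exists d.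
have [j0 cj0] := is_tail_corner tl.
pose E (j : 'I_K) := (m - ccons 0 t j + d j)%N.
case: (@arg_minnP _ j0 corner E cj0) => i ci minE.
have t0_gt0 : (0 < t 0%N)%N.
  have le0 k : (t k <= t 0%N)%N by elim: k => // k; apply: leq_trans.
  exact: leq_trans (leq_ltn_trans (leq0n _) cj0) (le0 _).
have rem0 (j : 'I_K) : (remove_box t j 0%N <= t 0%N)%N by rewrite leq_subr.
pose G b := \sum_(j < K | (t j.+1 < t j)%N)
  'X^(m - ccons 0 t j) * qnum (ccons b t j - t j).+1
    * stab_poly K m (remove_box t j) b.
have -> : stab_poly K m.+1 t = add_ones (t 0%N) G by [].
have valG b : (t 0%N <= b)%N -> xval (E i) (G b).
  move=> le; apply: (xval_sum (P := corner) (E := E)) => // j cj.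
  by apply: xval_qnum; apply: (dP j cj _ (leq_trans (rem0 j) le)).1.
exists (E i) => b le; split; first exact: add_ones_xval.
apply: add_ones_stable => // {le}b le.
rewrite -sumrB; apply: xdvd_sum => j cj.
apply: xdvd_leq (_ : _ <= E j + (b - t 0%N).+1)%N _.
  by rewrite leq_add2r; exact: minE.
have leb := leq_trans (rem0 j) le.
have [_ stabj] := dP j cj b leb; have [valj _] := dP j cj b leb.
rewrite /E -addnA; set p' := stab_poly _ _ _ b.+1 in stabj *.
set p := stab_poly _ _ _ b in stabj valj *.
rewrite -!mulrA -mulrBr; apply: xdvdM (xdvdXn _) _.
have diff : xdvd (d j + (b - t 0%N).+1) (p' - p).
  by apply: xdvd_leq stabj; rewrite leq_add2l ltnS leq_sub2l.
have qdiff q : xdvd (d j + (b - t 0%N).+1) (q * (p' - p)).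
  by rewrite -[(d j + _)%N]add0n; apply: xdvdM (xdvd_any q) diff.
clear stabj; clearbody p p'.
case: j {cj leb} valj diff qdiff => -[|j] ltj valj diff qdiff /=.
  rewrite subSn // qnumSr.
  have -> : (qnum (b - t 0%N).+1 + 'X^((b - t 0%N).+1)) * p' - qnum (b - t 0%N).+1 * p =
     (qnum (b - t 0%N).+1 + 'X^((b - t 0%N).+1)) * (p' - p)
       + p * 'X^((b - t 0%N).+1) by ring.
  by apply: xdvdD (qdiff _) _; apply: xdvdM (xval_xdvd valj) (xdvdXn _).
by rewrite -mulrBr.
Qed.

(** * From Jordan types to column profiles *)

(** A matrix with the profile of [lam] has some Jordan type [mu], whose profile
    is then that of [lam], and a partition is determined by its columns. *)
Lemma jordan_countE (F : finFieldType) n lam K :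
  is_partition n lam -> (n <= K)%N ->
  jordan_count F n lam = col_count F K n (parts_gt lam).
Proof.
move=> part leK; have [_ _ /eqP sm] := and3P part.
have supp k : (K <= k)%N -> parts_gt lam k = 0%N.
  move=> le; apply/eqP; rewrite -leqn0 leqNgt -has_count; apply/hasP => -[x xin].
  apply/negP; rewrite -leqNgt (leq_trans _ le) // (leq_trans _ leK) // -sm sumnE.
  by rewrite (big_rem x) //= leq_addr.
apply: eq_card => A; rewrite !inE; apply/andP/has_colsP => // -[su].
  by move=> /has_jordan_typeP sim; split=> //; apply: jordan_col_mxsimilar.
move=> cE; split=> //; apply/has_jordan_typeP.
have [mu [partmu _ sim]] := nilpotent_jordan_form (strictly_upper_nilpotent su).
rewrite (partition_parts_gt_inj part partmu) // => k.
by rewrite -(jordan_col_mxsimilar sim) cE.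
Qed.

Lemma parts_gt_tail K n lam : is_partition n lam -> (n <= K)%N ->
  is_tail K (n - size lam) (fun k => parts_gt lam k.+1).
Proof.
move=> /and3P[_ pos /eqP sm] leK.
have le x : x \in lam -> (x <= K)%N.
  move=> xin; rewrite (leq_trans _ leK) // -sm sumnE.
  by rewrite (big_rem x) //= leq_addr.
split.
- by move=> k; apply: sub_count => x; apply: ltnW.
- move=> k leKk; apply/eqP; rewrite -leqn0 leqNgt -has_count; apply/hasP => -[x /le].
  lia.
rewrite -sm; move: pos le; elim: lam {sm} => [|x lam IHlam] /=.
  by move=> _ _; rewrite big1.
move=> /andP[x_gt0 pos] le.
rewrite big_split /= IHlam => //; last first.
  by move=> y yin; apply: le; rewrite inE yin orbT.
have szs : (size lam <= sumn lam)%N.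
  by elim: lam pos {le IHlam} => //= y lam IHlam /andP[? /IHlam]; lia.
have -> : (\sum_(k < K) (k.+1 < x) = minn K x.-1)%N.
  by elim: (K) => [|k IHk]; rewrite ?big_ord0 ?min0n // big_ord_recr /= IHk; lia.
have := le x (mem_head _ _); lia.
Qed.

Lemma parts_gtE n lam : is_partition n lam ->
  parts_gt lam =1 ccons (size lam) (fun k => parts_gt lam k.+1).
Proof.
move=> /and3P[_ pos _] [|k] //=; apply/eqP; rewrite -all_count.
exact: pos.
Qed.

Lemma count_mem1_parts n lam : is_partition n lam ->
  count_mem 1%N lam = (size lam - parts_gt lam 1)%N.
Proof.
move=> /and3P[_ pos _]; rewrite /parts_gt.
rewrite -(count_predC (fun x => 1 < x)%N lam) addKn.
by apply: eq_in_count => x /(allP pos) /=; lia.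
Qed.

(** * Uniqueness of the polynomials *)
Lemma uniq_primes k : exists s : seq nat, [/\ uniq s, all prime s & size s = k].
Proof.
elim: k => [|k [s [us ps sz]]]; first by exists [::].
have [p ltp pp] := prime_above (sumn s).
exists (p :: s); split=> /=; rewrite ?us ?pp ?ps ?sz // andbT.
apply/negP => pin; move: ltp; rewrite sumnE (big_rem p) //= ltnNge leq_addr.
by [].
Qed.

(** The fields of prime order already give infinitely many values. *)
Lemma poly_eq_card (P Q : {poly int}) :
  (forall F : finFieldType, P.[#|F|%:R] = Q.[#|F|%:R]) -> P = Q.
Proof.
move=> E; apply/eqP; rewrite -subr_eq0; apply: contraT => D_neq0.
have [s [us ps sz]] := uniq_primes (size (P - Q)).
have := @max_poly_roots _ _ [seq p%:R | p <- s] D_neq0.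
rewrite size_map sz ltnn; apply.
  apply/allP => _ /mapP[p pin ->]; rewrite rootE hornerD hornerN.
  by have := E 'F_p; rewrite card_Fp ?(allP ps) // => ->; rewrite subrr.
by rewrite map_inj_uniq // => x y /eqP; rewrite eqr_nat => /eqP.
Qed.

Lemma XsubC_factor_uniq (c : int) d d' (A B : {poly int}) :
  ('X - c%:P) ^+ d * A = ('X - c%:P) ^+ d' * B ->
  A.[c] != 0 -> B.[c] != 0 -> A = B.
Proof.
wlog le : d d' A B / (d <= d')%N.
  move=> H E A0 B0; have [le|/ltnW le] := leqP d d'; first exact: H E A0 B0.
  by apply/esym; apply: H (esym E) B0 A0.
rewrite -(subnKC le) exprD -mulrA => /(mulfI (expf_neq0 d (negbT (polyXsubC_eq0 c)))) ->.
case: (d' - d)%N => [|k]; first by rewrite mul1r.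
by rewrite exprS !hornerM hornerXsubC subrr !mul0r eqxx.
Qed.

Lemma qQ_factorization_uniq P d e R d' e' R' :
  qQ_factorization P d e R -> qQ_factorization P d' e' R' -> R = R'.
Proof.
move=> [E R0 R1] [E' R0' R1'].
have nz k (S : {poly int}) : S.[0] != 0 -> (('X - 1) ^+ k * S).[0] != 0.
  move=> S0; rewrite hornerM horner_exp hornerXsubC sub0r mulf_neq0 //.
  by rewrite expf_neq0.
have := @XsubC_factor_uniq 0 d d' (('X - 1) ^+ e * R) (('X - 1) ^+ e' * R').
rewrite subr0 !mulrA -E -E' => /(_ erefl (nz _ _ R0) (nz _ _ R0')).
by move/(@XsubC_factor_uniq 1); apply.
Qed.

Lemma nneg_coef_horner1 r : nneg_coef r -> 0 < r`_0 -> r.[1] != 0.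
Proof.
move=> nn r0; rewrite horner_coef.
have : (0 < size r)%N.
  by rewrite lt0n size_poly_eq0; apply: contraTneq r0 => ->; rewrite coef0.
case: (size r) => // k _; rewrite big_ord_recl expr1n mulr1 lt0r_neq0 //.
rewrite ltr_wpDr //; apply: sumr_ge0 => i _; rewrite expr1n mulr1; exact: nn.
Qed.

(** The order of [P] at 0 is [b * (m - t 0) + dlt], and its order at 1 is [m]
    because [r], having nonnegative coefficients, does not vanish at 1. *)
Lemma jordan_count_polyE K n lam P d e R m t b dlt r :
    is_partition n lam -> (n <= K)%N ->
    is_jordan_count_poly n lam P -> qQ_factorization P d e R ->
    is_tail K m t -> (t 0%N <= b)%N -> n = (b + m)%N -> parts_gt lam =1 ccons b t ->
    stab_poly K m t b = 'X^dlt * r -> nneg_coef r -> 0 < r`_0 ->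
  R = r.
Proof.
move=> part leK Pcount Pfact tl leb nE lamE fE nn r0.
have PE : P = 'X^(b * (m - t 0%N)) * ('X - 1) ^+ m * stab_poly K m t b.
  apply: poly_eq_card => F; rewrite Pcount -(col_count_stab F tl leb).
  by rewrite (jordan_countE _ part (leqW leK)) nE (eq_col_count _ _ _ lamE).
apply: (qQ_factorization_uniq (d' := b * (m - t 0%N) + dlt) (e' := m) Pfact).
split; first by rewrite PE fE exprD; ring.
  by rewrite horner_coef0 lt0r_neq0.
exact: nneg_coef_horner1.
Qed.

(** * Adding a part equal to 1 *)
Theorem theorem6p1 (n : nat) (lam : seq nat)
    (P P' R R' : {poly int}) (d d' e e' : nat)
    (n_gt0 : (0 < n)%N)
    (lam_part : is_partition n lam)
    (P_count : is_jordan_count_poly n lam P)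
    (P'_count : is_jordan_count_poly n.+1 (rcons lam 1%N) P')
    (P_fact : qQ_factorization P d e R)
    (P'_fact : qQ_factorization P' d' e' R') :
  (forall i : nat, (i <= count_mem 1%N lam)%N -> R'`_i = R`_i) /\
  (exists S : {poly int}, R' - R = 'X^((count_mem 1%N lam).+1) * S).
Proof.
pose t k := parts_gt lam k.+1.
have part' : is_partition n.+1 (rcons lam 1%N).
  case/and3P: lam_part => srt pos /eqP sm; rewrite /is_partition all_rcons pos /=.
  rewrite -cats1 sumn_cat sm /= addn1 eqxx andbT cats1.
  case: (lam) srt pos => //= x s srt pos; rewrite rcons_path srt /=.
  by apply: (allP (pos : all (leq 1) (x :: s))); exact: mem_last.
have szn : (size lam <= n)%N.
  case/and3P: lam_part => _ pos /eqP <-.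
  by elim: (lam) pos => //= y s IHs /andP[? /IHs]; lia.
have nE : n = (size lam + (n - size lam))%N by rewrite subnKC.
have lamE := parts_gtE lam_part.
have lam'E : parts_gt (rcons lam 1%N) =1 ccons (size lam).+1 t.
  move=> k; rewrite /parts_gt -cats1 count_cat /= addn0 -/(parts_gt lam k) lamE.
  by case: k => [|k] /=; rewrite ?addn1 ?addn0.
have tl := parts_gt_tail lam_part (leqnSn n).
have leb : (t 0%N <= size lam)%N := count_size _ _.
have [dlt stab] := stab_poly_stable tl.
have [[r [rE nn r0]] [S SE]] := stab _ leb.
have [[r' [r'E nn' r0']] _] := stab _ (leqW leb).
have RE : R = r.
  exact: (jordan_count_polyE lam_part (leqnSn n) P_count P_fact tl leb nE lamE rE).
have R'E : R' = r'.
  apply: (jordan_count_polyE part' (leqnn _) P'_count P'_fact tl (leqW leb)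
    _ lam'E r'E) => //.
  by rewrite addSn -nE.
have main : R' - R = 'X^((count_mem 1%N lam).+1) * S.
  apply: (mulfI (expf_neq0 dlt (negbT (polyX_eq0 _)))).
  by rewrite mulrA -exprD mulrBr R'E RE -rE -r'E SE (count_mem1_parts lam_part).
split; last by exists S.
move=> i le; apply/eqP; rewrite -subr_eq0 -coefB main coefXnM ltnS le.
by [].
Qed.
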